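(* Let $p$ be a prime and let $\mathcal A$ be a finite set of powers of $p$ with $1\in\mathcal A$ and $|\mathcal A|\ge 2$. Then there exists a finite $p$-group $G$ of nilpotence class $2$ which is nested by degrees and satisfies $\mathrm{cd}(G)=\mathcal A$.
   Context: $\mathrm{cd}(G)=\{\chi(1):\chi\in\mathrm{Irr}(G)\}$ is the set of irreducible character degrees. For $\chi\in\mathrm{Irr}(G)$, $Z(\chi)=\{g\in G: |\chi(g)|=\chi(1)\}$. A group $G$ is nested by degrees if for all $\chi,\psi\in\mathrm{Irr}(G)$ with $\psi(1)\le\chi(1)$ we have $Z(\chi)\le Z(\psi)$. *)

(* Defs.v *)
From HB Require Import structures.
From mathcomp Require Import all_boot all_order all_algebra all_fingroup all_solvable all_field all_character.
Set Implicit Arguments. Unset Strict Implicit. Unset Printing Implicit Defensive.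
Import Order.TTheory GRing.Theory Num.Theory.
Local Open Scope ring_scope.

Definition chi_center (gT : finGroupType) (G : {group gT}) (i : Iirr G) : {set gT} :=
  [set g in G | `|'chi[G]_i g| == 'chi[G]_i 1%g].

Definition in_cd (gT : finGroupType) (G : {group gT}) (n : nat) : Prop :=
  exists i : Iirr G, 'chi[G]_i 1%g = n%:R.

Definition nested_by_degrees (gT : finGroupType) (G : {group gT}) : Prop :=
  forall i j : Iirr G, 'chi[G]_j 1%g <= 'chi[G]_i 1%g ->
    chi_center i \subset chi_center j.

(* Main.v *)
(* G is a Heisenberg-type group on triples (x, y, z) of vectors of length m over
   F_p, with central coordinate z and cocycle beta(x, y)_e = sum_(r+s=e) x_r y_s
   if p^(e+1) belongs to A, and 0 otherwise. Let chi be irreducible. If ker chi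
   contains every central coordinate line of index in the support of beta, chi is
   linear. Otherwise let e be the largest such index whose line is not in ker chi:
   modulo ker chi the commutator form is given by an anti-triangular Hankel matrix
   of size e+1, so Z(chi) consists of the (x, y, z) whose x and y vanish in
   positions 0..e. As G / Z(chi) is abelian, chi(1)^2 = |G : Z(chi)| = p^(2(e+1)).
   So Z(chi) is determined by chi(1) and decreases with it. *)
Require Import Defs.
From HB Require Import structures.
From mathcomp Require Import all_boot all_order all_algebra all_fingroup all_solvable all_field all_character.
From mathcomp Require Import pgroup nilpotent.
From mathcomp Require Import zify.

Set Implicit Arguments.
Unset Strict Implicit.
Unset Printing Implicit Defensive.
Import Order.TTheory GRing.Theory Num.Theory.

(** Padding with [a] leading zeros is a bijection from the rows of length [m - a]. *)
Lemma card_row_vanishing (F : finFieldType) (m a : nat) : a <= m ->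
  #|[set x : 'rV[F]_m | [forall r : 'I_m, (r < a)%N ==> (x ord0 r == 0%R)]]|
    = #|F| ^ (m - a).
Proof.
move/subnKC <-; rewrite addKn; move: (m - a) => b.
have injR: injective (row_mx (0 : 'rV[F]_a)%R : 'rV_b -> 'rV_(a + b)).
  by move=> x y /eq_row_mx[].
rewrite -[b in RHS]mul1n -card_mx -cardsT -(card_imset _ injR).
apply: eq_card => x; rewrite inE.
apply/forallP/imsetP => [x0 | [y _ ->] r].
  exists (rsubmx x); rewrite ?inE // -[LHS]hsubmxK; congr row_mx.
  apply/rowP=> r; rewrite !mxE; apply/eqP.
  exact: (implyP (x0 (lshift b r)) (ltn_ord r)).
by apply/implyP=> ra; rewrite (_ : r = lshift b (Ordinal ra)) ?row_mxEl ?mxE //; apply: val_inj.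
Qed.

(** * The bilinear map behind the cocycle *)

Section HankelHeisenberg.

Variables (F : finFieldType) (m : nat) (S : pred 'I_m).

Local Open Scope ring_scope.

Implicit Types x y z : 'rV[F]_m.

(** This multiplies [x] and [y] as polynomials modulo X^m, then keeps only the coefficients at
    positions in [S]. *)
Definition hankel x y : 'rV[F]_m :=
  \row_e if S e then \sum_(r < m) \sum_(s < m | (r + s == e)%N) x 0 r * y 0 s else 0.

Lemma hankelDl x1 x2 y : hankel (x1 + x2) y = hankel x1 y + hankel x2 y.
Proof.
apply/rowP=> e; rewrite !mxE; case: ifP => _; last by rewrite addr0.
rewrite -big_split; apply: eq_bigr => r _; rewrite -big_split.
by apply: eq_bigr => s _; rewrite mxE mulrDl.
Qed.

Lemma hankelC x y : hankel x y = hankel y x.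
Proof.
apply/rowP=> e; rewrite !mxE; case: ifP => // _.
rewrite (exchange_big_dep predT) //=; apply: eq_bigr => r _.
by apply: eq_big => [s|s _]; [rewrite addnC | rewrite mulrC].
Qed.

Lemma hankelDr x y1 y2 : hankel x (y1 + y2) = hankel x y1 + hankel x y2.
Proof. by rewrite hankelC hankelDl -!(hankelC x). Qed.

Lemma hankel0l y : hankel 0 y = 0.
Proof. by apply: (addrI (hankel 0 y)); rewrite -hankelDl !addr0. Qed.

Lemma hankel0r x : hankel x 0 = 0.
Proof. by rewrite hankelC hankel0l. Qed.

Lemma hankelNl x y : hankel (- x) y = - hankel x y.
Proof. by apply/eqP; rewrite -addr_eq0 -hankelDl addNr hankel0l. Qed.

Lemma hankel_delta x s c e :
  hankel x (c *: delta_mx 0 s) 0 e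
    = if S e then \sum_(r < m | (r + s == e)%N) x 0 r * c else 0.
Proof.
rewrite mxE; case: ifP => // _; rewrite [RHS]big_mkcond /=.
apply: eq_bigr => r _; case: ifPn => rs.
  rewrite (bigD1 s) //= big1 => [|t /andP[_ ts]]; rewrite !mxE ?eqxx ?addr0 ?mulr1 //.
  by rewrite (negPf ts) !mulr0.
rewrite big1 // => t rt; rewrite !mxE /=; case: eqP => [ts|]; rewrite ?mulr0 //.
by rewrite ts (negPf rs) in rt.
Qed.

Lemma hankel_low (a : nat) x y (e : 'I_m) :
  (forall r : 'I_m, (r < a)%N -> x 0 r = 0) -> (e < a)%N -> hankel x y 0 e = 0.
Proof.
move=> x0 ea; rewrite mxE; case: ifP => // _; apply: big1 => r _.
apply: big1 => s /eqP rs; rewrite x0 ?mul0r //.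
by apply: leq_ltn_trans ea; rewrite -rs leq_addr.
Qed.

Lemma hankel_outside x y e : ~~ S e -> hankel x y 0 e = 0.
Proof. by rewrite mxE => /negPf->. Qed.

(* The unused argument records S, so that the group law can be inferred from the type. *)
Definition heis_of of pred 'I_m : Type := ('rV[F]_m * 'rV[F]_m * 'rV[F]_m)%type.

(** * The Heisenberg-type group and its commutators *)

Local Notation heis := (heis_of S).

HB.instance Definition _ := Finite.on heis.

Definition heis_one : heis := (0, 0, 0).
(** The law of unitriangular 3 by 3 matrices, with [hankel] as the product of off-diagonal
    entries. *)
Definition heis_mul (g h : heis) : heis :=
  (g.1.1 + h.1.1, g.1.2 + h.1.2, g.2 + h.2 + hankel g.1.1 h.1.2).
Definition heis_inv (g : heis) : heis :=
  (- g.1.1, - g.1.2, - g.2 + hankel g.1.1 g.1.2).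

Lemma heis_mulA : associative heis_mul.
Proof.
case=> [[x y] z] [[x' y'] z'] [[x'' y''] z'']; rewrite /heis_mul /=.
congr (_, _, _); rewrite ?addrA // hankelDl hankelDr.
by rewrite !addrA [LHS](AC 6 (1*2*5*3*6*4)).
Qed.

Lemma heis_mul1 : left_id heis_one heis_mul.
Proof. by case=> [[x y] z]; rewrite /heis_mul /= hankel0l !add0r addr0. Qed.

Lemma heis_mulV : left_inverse heis_one heis_inv heis_mul.
Proof.
case=> [[x y] z]; rewrite /heis_mul /= hankelNl !addNr.
by rewrite [_ + _ + z]addrAC addNr add0r subrr.
Qed.

HB.instance Definition _ :=
  Finite_isGroup.Build heis heis_mulA heis_mul1 heis_mulV.

Local Open Scope group_scope.

Lemma heis_mulE (g h : heis) : g * h = heis_mul g h. Proof. by []. Qed.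

Definition central z : heis := (0%R, 0%R, z).

Lemma centralD z z' : central (z + z')%R = central z * central z'.
Proof. by rewrite heis_mulE /heis_mul /= hankel0l !addr0. Qed.

Definition comm_form (g h : heis) : 'rV[F]_m :=
  (hankel g.1.1 h.1.2 - hankel h.1.1 g.1.2)%R.

Lemma heis_commE (g h : heis) : [~ g, h] = central (comm_form g h).
Proof.
apply: (mulgI (h * g)); rewrite -commgC !heis_mulE /heis_mul /= !addr0 hankel0r addr0.
congr (_, _, _); [exact: addrC | exact: addrC |].
by rewrite /comm_form [(hankel _ _ - _)%R]addrC addrA addrK [(h.2 + _)%R]addrC.
Qed.

Lemma central_in_center z : central z \in 'Z([set: heis]).
Proof.
apply/centerP; split=> [|h _]; first by rewrite inE.
apply/commgP; rewrite heis_commE /comm_form /= hankel0l hankel0r subrr.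
by apply/eqP.
Qed.

Lemma heis_der1_center : [set: heis]^`(1) \subset 'Z([set: heis]).
Proof.
rewrite gen_subG; apply/subsetP=> _ /imset2P[g h _ _ ->].
by rewrite heis_commE central_in_center.
Qed.

Lemma card_heis : #|[set: heis]| = (#|F| ^ (m * 3))%N.
Proof. by rewrite cardsT !card_prod card_mx mul1n expnM !expnS muln1 mulnA. Qed.

(** * The chain of candidate centres *)

Definition deep (a : nat) : {set heis} :=
  [set g : heis | [forall r : 'I_m, (r < a)%N ==> (g.1.1 ord0 r == 0%R)]
               && [forall r : 'I_m, (r < a)%N ==> (g.1.2 ord0 r == 0%R)]].

Lemma deepP a (g : heis) :
  reflect (forall r : 'I_m, (r < a)%N -> g.1.1 ord0 r = 0%R /\ g.1.2 ord0 r = 0%R)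
          (g \in deep a).
Proof.
rewrite inE; apply: (iffP andP) => [[/forallP gx /forallP gy] r ra | gr].
  by split; apply/eqP; [apply: (implyP (gx r)) | apply: (implyP (gy r))].
by split; apply/forallP => r; apply/implyP=> /gr[gx gy]; rewrite ?gx ?gy.
Qed.

Lemma deep_antimonotone a b : (a <= b)%N -> deep b \subset deep a.
Proof.
move=> ab; apply/subsetP=> g /deepP gb; apply/deepP=> r ra.
exact: gb (leq_trans ra ab).
Qed.

Lemma card_deep a : (a <= m)%N -> (#|deep a| * (#|F| ^ a) ^ 2 = #|[set: heis]|)%N.
Proof.
move=> am; pose low := [set x : 'rV[F]_m | [forall r : 'I_m, (r < a)%N ==> (x ord0 r == 0%R)]].
have -> : #|deep a| = #|setX (setX low low) [set: 'rV[F]_m]|.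
  by apply: eq_card => g; rewrite !inE andbT.
rewrite !cardsX cardsT !card_row_vanishing // card_mx mul1n card_heis.
rewrite -expnM -!expnD; congr (_ ^ _)%N; lia.
Qed.

(** * Centres and degrees of irreducible characters *)

Section Characters.

Variable i : Iirr [set: heis].

(* The centre of chi is the preimage of the centre of G / ker chi. *)
Lemma irr_center_commP (g : heis) :
  reflect (forall h, central (comm_form g h) \in cfker 'chi_i) (g \in 'Z('chi_i)%CF).
Proof.
have nK (A : {set heis}) : A \subset 'N(cfker 'chi_i).
  by rewrite (subset_trans (subsetT A)) ?normal_norm ?cfker_normal.
have kerZ := normal_sub (cfker_center_normal 'chi_i).
rewrite -sub1set -(quotientSGK (nK _) kerZ) cfcenter_eq_center subsetI.
rewrite quotientS ?subsetT // quotient_cents2 ?nK //= gen_subG.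
apply: (iffP subsetP) => [gK h | gK _ /imset2P[_ h /set1P-> _ ->]].
  by rewrite -heis_commE gK // imset2_f ?inE.
by rewrite heis_commE.
Qed.

(** [central] is additive and the kernel is a group, so membership can be tested on coordinate
    lines. *)
Lemma central_support_cfker (P : pred 'I_m) z :
  (forall j, ~~ P j -> z ord0 j = 0%R) ->
  (forall j c, P j -> central (c *: delta_mx 0 j)%R \in cfker 'chi_i) ->
  central z \in cfker 'chi_i.
Proof.
move=> z0 zP; rewrite (row_sum_delta z).
apply: (big_ind (fun z => central z \in cfker 'chi_i)) => [|u v uK vK|j _].
- exact: group1.
- by rewrite centralD groupM.
have [/zP-> // | /z0->] := boolP (P j).
by rewrite scale0r; exact: group1.
Qed.

(** Triangular elimination: if [x] vanishes before [r], pairing it with a basis vector at [e - r]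
    gives nothing below [e] and a multiple of [x_r] at [e], while coordinates above [e] die in the
    kernel. Hence a nonzero [x_r] would force the excluded element at [e] into the kernel. *)
Lemma irr_center_deep (e : 'I_m) c : S e ->
    central (c *: delta_mx 0 e)%R \notin cfker 'chi_i ->
    (forall j c', S j && (e < j)%N ->
       central (c' *: delta_mx 0 j)%R \in cfker 'chi_i) ->
  'Z('chi_i)%CF = deep e.+1.
Proof.
move=> Se cK topK; pose P (j : 'I_m) := S j && (e < j)%N.
have inK z : (forall j, ~~ P j -> z ord0 j = 0%R) -> central z \in cfker 'chi_i.
  by move=> z0; apply: (central_support_cfker z0).
have low0 x : (forall y, central (hankel x y) \in cfker 'chi_i) ->
    forall r : 'I_m, (r < e.+1)%N -> x ord0 r = 0%R.
  move=> xK r; have [n] := ubnP (r : nat); elim: n r => // n IHn r rn re.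
  apply: contraNeq cK => xr0.
  have s_lt : (e - r < m)%N by apply: leq_ltn_trans (ltn_ord e); apply: leq_subr.
  (* The scalar is chosen so that coordinate [e] of [w] is exactly [c]; the difference from the
     excluded element then lies in the kernel. *)
  pose w := hankel x (c / x ord0 r *: delta_mx 0 (Ordinal s_lt))%R.
  rewrite -(groupMl _ (_ : central (w - c *: delta_mx 0 e)%R \in _)); last first.
    apply: inK => j; rewrite /P negb_and mxE hankel_delta !mxE /= -leqNgt.
    have [->|je] := eqVneq j e.
      rewrite Se leqnn => _; rewrite (big_pred1 r) => [|t] /=.
        by rewrite mulr1 mulrC divfK ?subrr.
      by rewrite -[X in _ == X](subnKC (_ : r <= e)%N) ?eqn_add2r.
    rewrite mulr0 subr0; case: ifP => //= Sj je'; apply: big1 => t /eqP tj.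
    have {je}je : (j < e)%N by rewrite ltn_neqAle (inj_eq val_inj) je.
    rewrite (IHn t) ?mul0r //; lia.
  by rewrite -centralD subrK xK.
apply/setP=> g; apply/irr_center_commP/deepP => [gK r re | g0 h].
  (* Commuting with (0, y, 0) tests the first component of [g]; commuting with (-y, 0, 0) tests the
     second, by symmetry of [hankel]. *)
  split; apply: low0 re => y.
    by have := gK (0%R, y, 0%R); rewrite /comm_form /= hankel0l subr0.
  have := gK ((- y)%R, 0%R, 0%R).
  by rewrite /comm_form /= hankel0r sub0r hankelNl opprK hankelC.
apply: inK => j; rewrite /P negb_and -leqNgt => /orP[Sj | je].
  by rewrite !mxE (negPf Sj) subrr.
by rewrite [LHS]mxE [X in (_ + X)%R]mxE (hankelC h.1.1) !(@hankel_low e.+1) ?subrr // => r /g0[].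
Qed.

Lemma irr_center_cases :
  'Z('chi_i)%CF = deep 0 \/ exists2 e, S e & 'Z('chi_i)%CF = deep e.+1.
Proof.
pose P e := S e && [exists c, central (c *: delta_mx 0 e)%R \notin cfker 'chi_i].
have inK j c' : S j && ~~ P j -> central (c' *: delta_mx 0 j)%R \in cfker 'chi_i.
  case/andP=> Sj; rewrite /P Sj /= negb_exists => /forallP/(_ c').
  by rewrite negbK.
have [e0 Pe0 | P0] := pickP P; [right | left].
  case: (arg_maxnP (fun e : 'I_m => e : nat) Pe0) => e /andP[Se /existsP[c cK]] e_max.
  exists e => //; apply: irr_center_deep Se cK _ => j c' /andP[Sj ej].
  by apply: inK; rewrite Sj /=; apply: contraL ej => /e_max; rewrite -leqNgt.
(* [deep 0] is the whole group; here every line in the support, hence every commutator, is in the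
   kernel. *)
apply/setP=> g; rewrite (_ : (g \in deep 0) = true); last exact/deepP.
apply/irr_center_commP=> h; apply: (@central_support_cfker S) => j.
  by move=> Sj; rewrite !mxE (negPf Sj) subrr.
by move=> c Sj; apply: inK; rewrite Sj P0.
Qed.

Lemma irr_degree a : (a <= m)%N -> 'Z('chi_i)%CF = deep a ->
  'chi_i 1 = (#|F| ^ a)%:R%R.
Proof.
move=> am Zi; have abG: abelian ([set: heis] / 'Z('chi_i)%CF).
  apply: sub_der1_abelian; apply: subset_trans heis_der1_center _.
  by rewrite -cap_cfcenter_irr bigcap_inf.
apply: (@pexpIrn _ 2); rewrite ?nnegrE ?ler0n ?(ltW (irr1_gt0 _)) //.
rewrite (irr1_abelian_bound abG) -natrX; congr _%:R%R.
apply/eqP; rewrite -(eqn_pmul2l (cardG_gt0 (cfcenter_group 'chi_i))) /=.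
by rewrite (Lagrange (cfcenter_sub 'chi_i)) Zi; apply/eqP; rewrite -(card_deep am).
Qed.

End Characters.

(** The central elements with zero coordinate [e] form a normal subgroup [K]. It is the intersection
    of the irreducible kernels containing it, so one of these misses the unit vector at [e], yet
    contains all lines beyond [e]. *)
Lemma exists_irr_center_deep e : S e ->
  exists i : Iirr [set: heis], 'Z('chi_i)%CF = deep e.+1.
Proof.
move=> Se; pose K := [set central z | z in [pred z : 'rV[F]_m | z ord0 e == 0%R]].
have gK : group_set K.
  apply/group_setP; split=> [|_ _ /imsetP[u /eqP u0 ->] /imsetP[v /eqP v0 ->]].
    by apply/imsetP; exists 0%R; rewrite // inE mxE.
  by rewrite -centralD imset_f // inE mxE u0 v0 addr0.
have nK : Group gK <| [set: heis].
  apply: sub_center_normal; apply/subsetP=> _ /imsetP[z _ ->].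
  exact: central_in_center.
pose d := central (1 *: delta_mx 0 e)%R.
have [i /andP[Ki di] | no_i] := pickP [pred i : Iirr [set: heis] |
    (Group gK \subset cfker 'chi_i) && (d \notin cfker 'chi_i)].
  exists i; apply: irr_center_deep Se di _ => j c /andP[_ ej].
  have /negPf je : e != j by apply: contraL ej => /eqP->; rewrite ltnn.
  by rewrite (subsetP Ki) // imset_f // inE !mxE /= je mulr0.
have : d \in \bigcap_(i | Group gK \subset cfker 'chi[[set: heis]]_i) cfker 'chi_i.
  apply/bigcapP=> i Ki; have := no_i i; rewrite /= Ki /=.
  by move/negbFE.
rewrite cap_cfker_normal // => /imsetP[z z0 [zd]].
by move: z0; rewrite inE -zd !mxE !eqxx mulr1 oner_eq0.
Qed.

(** * Nesting, degree set and nilpotency class *)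

Lemma chi_centerE (i : Iirr [set: heis]) : chi_center i = 'Z('chi_i)%CF.
Proof.
by apply/setP=> g; rewrite irr_cfcenterE ?inE.
Qed.

Lemma heis_irrP (i : Iirr [set: heis]) : exists a,
  [/\ 'Z('chi_i)%CF = deep a, 'chi_i 1 = (#|F| ^ a)%:R%R
    & a = 0 \/ exists2 e, S e & a = e.+1].
Proof.
have [Zi | [e Se Zi]] := irr_center_cases i.
  by exists 0; split; rewrite ?(@irr_degree i 0) //; left.
by exists e.+1; split; rewrite ?(@irr_degree i e.+1) //; right; exists e.
Qed.

Lemma heis_nested : nested_by_degrees [set: heis].
Proof.
move=> i j; rewrite !chi_centerE.
have [a [-> -> _]] := heis_irrP i; have [b [-> -> _]] := heis_irrP j.
by rewrite ler_nat leq_exp2l ?finNzRing_gt1 // => /deep_antimonotone.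
Qed.

Lemma heis_in_cdP n : in_cd [set: heis] n <->
  n = 1%N \/ exists2 e, S e & n = (#|F| ^ e.+1)%N.
Proof.
split=> [[i] | [-> | [e Se ->]]].
- have [a [_ -> a_or]] := heis_irrP i; move/eqP; rewrite eqr_nat => /eqP<-.
  by case: a_or => [-> | [e Se ->]]; [left | right; exists e].
- by exists 0; rewrite irr0 cfun11.
have [i Zi] := exists_irr_center_deep Se.
by exists i; apply: irr_degree.
Qed.

(** Derived subgroup in the centre bounds the class by 2; a position in [S] yields a nonlinear
    character, so the group is not abelian. *)
Lemma heis_nil_class e : S e -> nil_class [set: heis] = 2.
Proof.
move=> Se; apply/eqP; rewrite eqn_leq nil_class2 heis_der1_center ltnNge nil_class1.
apply/char_abelianP=> lin; have [i Zi] := exists_irr_center_deep Se.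
have := irr_degree (ltn_ord e) Zi; rewrite lin_char1 // => /eqP.
by rewrite (eqr_nat _ 1) eq_sym gtn_eqF // -(expn0 #|F|) ltn_exp2l // finNzRing_gt1.
Qed.

Lemma heis_pgroup p : (p.-nat #|F|)%N -> p.-group [set: heis].
Proof. by move=> pF; rewrite /pgroup card_heis pnatX pF. Qed.

End HankelHeisenberg.

(** * The group for a prescribed degree set *)

Theorem theorem1p6 (p : nat) (A : seq nat) :
  prime p ->
  uniq A ->
  (forall a, a \in A -> exists k, a = p ^ k) ->
  1 \in A ->
  2 <= size A ->
  exists (gT : finGroupType) (G : {group gT}),
    [/\ (p.-group G)%g, nil_class G = 2, nested_by_degrees G &
        forall n, n \in A <-> in_cd G n].
Proof.
move=> p_pr uA powA A1 szA.
(* Position [e] encodes the degree [p ^ e.+1]: degree 1 always occurs and needs no position. The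
   length is the largest exponent in [A], so each nontrivial degree has its position. *)
pose S (e : 'I_(\max_(a <- A) logn p a)) := p ^ e.+1 \in A.
have AP n : n \in A <-> n = 1 \/ exists2 e, S e & n = p ^ e.+1.
  split=> [nA | [-> // | [e Se ->]] //].
  have [[|k] nk] := powA n nA; [by left | right].
  have km : k < \max_(a <- A) logn p a.
    by rewrite -(pfactorK k.+1 p_pr) -nk (leq_bigmax_seq (F := logn p)).
  by exists (Ordinal km); rewrite // /S -nk.
have [e Se] : exists e, S e.
  (* Otherwise the duplicate-free [A] would embed in a one-element list. *)
  have [n nA n1] : exists2 n, n \in A & n != 1.
    apply/hasP; rewrite -[has _ _]negbK -all_predC; apply/negP=> /allP A1'.
    have : size A <= size [:: 1].
      apply: uniq_leq_size => // n /A1' /=; rewrite negbK => /eqP->.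
      exact: mem_head.
    by rewrite leqNgt szA.
  by have [/eqP | [e Se _]] := (AP n).1 nA; [rewrite (negPf n1) | exists e].
have cF := card_Fp p_pr.
exists (heis_of 'F_p S), [set: heis_of 'F_p S]%G; split.
- by apply: heis_pgroup; rewrite cF pnat_id.
- exact: heis_nil_class Se.
- exact: heis_nested.
by move=> n; rewrite AP heis_in_cdP cF.
Qed.
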